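(* Let $n$ be a positive integer, let $R$ be a ring and let $S$ be a simple left $R$-module. Then $\Delta(S)$ is a simple left $MC_n(R)$-module.
   Context: All rings are associative with $1$; modules are left unitary modules. $M_m(R)$ is the ring of $m\times m$ matrices over $R$. Fix $n\ge 1$ and identify $M_n(M_{n^k}(R))$ with $M_{n^{k+1}}(R)$ via block matrices. The $n$-matricial closure $MC_n(R)$ is the direct limit of the rings $M_{n^k}(R)$, $k\in\mathbb{N}=\{0,1,2,\dots\}$ (with $M_{n^0}(R)=R$), along the injective ring morphisms $M_{n^k}(R)\to M_{n^{k+1}}(R)$ sending $A$ to the block diagonal matrix with $n$ diagonal blocks equal to $A$. For a left $R$-module $M$, $\delta_k(M)=M^{n^k}$ is the left $M_{n^k}(R)$-module of column vectors, with the usual action $(A\varphi)(r)=\sum_{s}A_{rs}\varphi(s)$ for $A\in M_{n^k}(R)$, $\varphi\in M^{n^k}$. Identifying $M^{n^{k+1}}=(M^{n^k})^n$ compatibly with the block identification of matrices, the connecting maps are the diagonal maps $M^{n^k}\to M^{n^{k+1}}$, $v\mapsto(v,\dots,v)$, which are compatible with the ring maps $M_{n^k}(R)\to M_{n^{k+1}}(R)$. $\Delta(M)=\varinjlim_k \delta_k(M)$ is the direct limit, with its induced structure of left $MC_n(R)$-module. *)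

(* Defs.v *)
(* Rings are pzRingType, so the zero ring is allowed.  Classical logic (boolp)
   only makes boolean the relation that defines the direct limit. *)
From HB Require Import structures.
From mathcomp Require Import all_boot all_order all_algebra.
From mathcomp Require Import boolp.

Set Implicit Arguments.
Unset Strict Implicit.
Unset Printing Implicit Defensive.

Import GRing.Theory.

Local Open Scope ring_scope.
Local Open Scope quotient_scope.

Section DirectLimit.
Variables (T : nat -> choiceType) (f : forall k, T k -> T k.+1).

Fixpoint dl_iter k m (x : T k) : T (m + k)%N :=
  if m is m'.+1 then f (dl_iter m' x) else x.

(* The composite of the connecting maps T k -> T k.+1 -> ... -> T l. *)
Definition dl_map k l (kl : (k <= l)%N) (x : T k) : T l :=
  ecast j (T j) (subnK kl) (dl_iter (l - k) x).

Lemma dl_iterE k l (kl : (k <= l)%N) m (e : (m + k)%N = l) (x : T k) :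
  dl_map kl x = ecast j (T j) e (dl_iter m x).
Proof.
have em : m = (l - k)%N by rewrite -e addnK.
rewrite /dl_map; move: (subnK kl); rewrite -em => e'.
by rewrite (eq_irrelevance e' e).
Qed.

Lemma dl_map_id k (kk : (k <= k)%N) x : dl_map kk x = x.
Proof. by rewrite (dl_iterE kk (m := 0%N) erefl). Qed.

Lemma dl_mapS k l (kl : (k <= l)%N) (kSl : (k <= l.+1)%N) x :
  dl_map kSl x = f (dl_map kl x).
Proof.
have [m e] : exists m, (m + k)%N = l by exists (l - k)%N; rewrite subnK.
have eS : (m.+1 + k)%N = l.+1 by rewrite addSn e.
rewrite (dl_iterE kl e) (dl_iterE kSl eS) /=.
by case: l / e eS {kl kSl} => eS; rewrite (eq_irrelevance eS erefl).
Qed.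

Lemma dl_map_irr k l (h h' : (k <= l)%N) x : dl_map h x = dl_map h' x.
Proof. by rewrite (bool_irrelevance h h'). Qed.

Lemma dl_map_comp k l m (kl : (k <= l)%N) (lm : (l <= m)%N) (km : (k <= m)%N) x :
  dl_map lm (dl_map kl x) = dl_map km x.
Proof.
elim: m lm km => [|m IHm] lm km.
  have l0 : l = 0%N by apply/eqP; rewrite -leqn0.
  by subst; rewrite dl_map_id (dl_map_irr kl km).
have [lm'|ml] := leqP l m.
  have km' := leq_trans kl lm'.
  by rewrite (dl_mapS lm') (dl_mapS km') (IHm _ km').
have lE : l = m.+1 by apply/eqP; rewrite eqn_leq lm.
by subst; rewrite dl_map_id (dl_map_irr kl km).
Qed.

Definition dl_rel (p q : {k & T k}) : bool :=
  `[< exists l (hp : (tag p <= l)%N) (hq : (tag q <= l)%N),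
        dl_map hp (tagged p) = dl_map hq (tagged q) >].

Fact dl_rel_equiv : equiv_class_of dl_rel.
Proof.
split=> [p|p q|q p r].
- by apply/asboolP; exists (tag p), (leqnn _), (leqnn _).
- by apply/asboolP/asboolP => -[l [hp [hq e]]]; exists l, hq, hp.
- move=> /asboolP[l [hp [hq e]]] /asboolP[m [hq' [hr e']]]; apply/asboolP.
  have hl := leq_maxl l m; have hm := leq_maxr l m.
  exists (maxn l m), (leq_trans hp hl), (leq_trans hr hm).
  rewrite -(dl_map_comp hp hl) -(dl_map_comp hr hm) e -e'.
  by rewrite !(dl_map_comp _ _ (leq_trans hq hl)).
Qed.

Canonical dl_equiv := EquivRelPack dl_rel_equiv.

(* The disjoint union of the T k modulo equality at some later stage. *)
Definition dirlim : Type := {eq_quot dl_equiv}.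

HB.instance Definition _ := Choice.on dirlim.

Definition dl_in k (x : T k) : dirlim := \pi_{eq_quot dl_equiv} (Tagged T x).

Lemma dl_in_eqP k l (x : T k) (y : T l) :
  dl_in x = dl_in y <->
  exists m (hk : (k <= m)%N) (hl : (l <= m)%N), dl_map hk x = dl_map hl y.
Proof.
by split=> [/eqmodP/asboolP//|xy]; apply/eqmodP/asboolP.
Qed.

Lemma dl_in_map k l (kl : (k <= l)%N) x : dl_in (dl_map kl x) = dl_in x.
Proof.
by apply/dl_in_eqP; exists l, (leqnn l), kl; rewrite dl_map_id.
Qed.

Lemma dl_inS k (x : T k) : dl_in (f x) = dl_in x.
Proof. by rewrite -(dl_in_map (leqnSn k)) (dl_mapS (leqnn k)) dl_map_id. Qed.

Lemma dl_inP (X : dirlim) : exists k (x : T k), X = dl_in x.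
Proof.
exists (tag (repr X)), (tagged (repr X)).
by rewrite /dl_in; case: (repr X) (reprK X) => k x /= ->.
Qed.

Lemma dl_inW k (x : T k) l : (k <= l)%N -> exists y : T l, dl_in x = dl_in y.
Proof. by move=> kl; exists (dl_map kl x); rewrite dl_in_map. Qed.

Lemma dl_inP_ge k0 (X : dirlim) : exists k (x : T k), (k0 <= k)%N /\ X = dl_in x.
Proof.
have [k [x ->]] := dl_inP X.
have [y ->] := dl_inW x (leq_maxr k0 k).
by exists (maxn k0 k), y; split=> //; exact: leq_maxl.
Qed.

End DirectLimit.

Section DirectLimitOp.
Variables (T U V : nat -> choiceType).
Variables (f : forall k, T k -> T k.+1) (g : forall k, U k -> U k.+1).
Variables (h : forall k, V k -> V k.+1).

Lemma dl_inP2 (X : dirlim f) (Y : dirlim g) :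
  exists k (x : T k) (y : U k), X = dl_in f x /\ Y = dl_in g y.
Proof.
have [k [x ->]] := dl_inP X; have [l [y [kl ->]]] := dl_inP_ge k Y.
by have [x' ->] := dl_inW f x kl; exists l, x', y.
Qed.

Definition dl_op1 (op : forall k, T k -> V k) (X : dirlim f) : dirlim h :=
  dl_in h (op _ (tagged (repr X))).

(* Representatives are brought to a common stage before applying op. *)
Definition dl_op2 (op : forall k, T k -> U k -> V k)
    (X : dirlim f) (Y : dirlim g) : dirlim h :=
  let: existT k x := repr X in let: existT l y := repr Y in
  dl_in h (op _ (dl_map f (leq_maxl k l) x) (dl_map g (leq_maxr k l) y)).

Lemma dl_op1E (op : forall k, T k -> V k) :
  (forall k x, op k.+1 (f x) = h (op k x)) ->
  forall k (x : T k), dl_op1 op (dl_in f x) = dl_in h (op k x).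
Proof.
move=> opf k x; have opM i j (ij : (i <= j)%N) a :
    op j (dl_map f ij a) = dl_map h ij (op i a).
  elim: j ij => [|j IHj] ij.
    have i0 : i = 0%N by apply/eqP; rewrite -leqn0.
    by subst; rewrite !dl_map_id.
  have [ij'|ji] := leqP i j; first by rewrite !(dl_mapS _ ij') opf IHj.
  have iE : i = j.+1 by apply/eqP; rewrite eqn_leq ij.
  by subst; rewrite !dl_map_id.
rewrite /dl_op1; have := reprK (dl_in f x).
case: (repr _) => l y /= /dl_in_eqP[m [hl [hk e]]].
by rewrite -(dl_in_map h hl) -opM e opM dl_in_map.
Qed.

Lemma dl_op2E (op : forall k, T k -> U k -> V k) :
  (forall k x y, op k.+1 (f x) (g y) = h (op k x y)) ->
  forall k (x : T k) (y : U k),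
    dl_op2 op (dl_in f x) (dl_in g y) = dl_in h (op k x y).
Proof.
move=> opf k x y; have opM i j (ij : (i <= j)%N) a b :
    op j (dl_map f ij a) (dl_map g ij b) = dl_map h ij (op i a b).
  elim: j ij => [|j IHj] ij.
    have i0 : i = 0%N by apply/eqP; rewrite -leqn0.
    by subst; rewrite !dl_map_id.
  have [ij'|ji] := leqP i j; first by rewrite !(dl_mapS _ ij') opf IHj.
  have iE : i = j.+1 by apply/eqP; rewrite eqn_leq ij.
  by subst; rewrite !dl_map_id.
rewrite /dl_op2; have := reprK (dl_in f x); have := reprK (dl_in g y).
case: (repr _) => j b; case: (repr _) => i a /=.
move=> /dl_in_eqP[m [hj [hk e]]] /dl_in_eqP[m' [hi [hk' e']]].
have M1 := leq_maxl (maxn m m') (maxn i j).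
have M2 := leq_maxr (maxn m m') (maxn i j).
have mM := leq_trans (leq_maxl m m') M1.
have m'M := leq_trans (leq_maxr m m') M1.
rewrite -(dl_in_map h M2) -opM -(dl_in_map h (leq_trans hk mM)) -opM.
congr (dl_in h (op _ _ _)).
  rewrite (dl_map_comp _ _ _ (leq_trans hi m'M)) -(dl_map_comp _ hi m'M) e'.
  exact: dl_map_comp.
rewrite (dl_map_comp _ _ _ (leq_trans hj mM)) -(dl_map_comp _ hj mM) e.
exact: dl_map_comp.
Qed.

End DirectLimitOp.

Lemma dl_inP3 (T U V : nat -> choiceType) (f : forall k, T k -> T k.+1)
    (g : forall k, U k -> U k.+1) (h : forall k, V k -> V k.+1)
    (X : dirlim f) (Y : dirlim g) (Z : dirlim h) :
  exists k (x : T k) (y : U k) (z : V k),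
    [/\ X = dl_in f x, Y = dl_in g y & Z = dl_in h z].
Proof.
have [k [x [y [-> ->]]]] := dl_inP2 X Y; have [l [z [kl ->]]] := dl_inP_ge k Z.
have [x' ->] := dl_inW f x kl; have [y' ->] := dl_inW g y kl.
by exists l, x', y', z.
Qed.

Section ZmodDirectLimit.
Variables (A : nat -> zmodType) (f : forall k, {additive A k -> A k.+1}).

Definition zmod_dirlim : Type := @dirlim (fun k => A k) (fun k => f k).

HB.instance Definition _ := Choice.on zmod_dirlim.

Definition zlim_in k (x : A k) : zmod_dirlim :=
  @dl_in (fun k => A k) (fun k => f k) k x.

Let zlim0 : zmod_dirlim := zlim_in (0 : A 0).
Let zlim_opp : zmod_dirlim -> zmod_dirlim := dl_op1 _ (fun k x => - x).
Let zlim_add : zmod_dirlim -> zmod_dirlim -> zmod_dirlim :=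
  dl_op2 _ (fun k x y => x + y).

Let zlim0E k : zlim0 = zlim_in (0 : A k).
Proof.
elim: k => // k ->; rewrite -[in RHS](raddf0 (f k)).
exact/esym/(@dl_inS (fun k => A k) (fun k => f k)).
Qed.

Let zlim_oppE k (x : A k) : zlim_opp (zlim_in x) = zlim_in (- x).
Proof. by apply: dl_op1E => {}k {}x; rewrite raddfN. Qed.

Let zlim_addE k (x y : A k) :
  zlim_add (zlim_in x) (zlim_in y) = zlim_in (x + y).
Proof. by apply: dl_op2E => {}k {}x {}y; rewrite raddfD. Qed.

Let zlim_addA : associative zlim_add.
Proof.
move=> X Y Z; have [k [x [y [z [-> -> ->]]]]] := dl_inP3 X Y Z.
by rewrite !zlim_addE addrA.
Qed.

Let zlim_addC : commutative zlim_add.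
Proof.
move=> X Y; have [k [x [y [-> ->]]]] := dl_inP2 X Y.
by rewrite !zlim_addE addrC.
Qed.

Let zlim_add0 : left_id zlim0 zlim_add.
Proof.
by move=> X; have [k [x ->]] := dl_inP X; rewrite (zlim0E k) zlim_addE add0r.
Qed.

Let zlim_addN : left_inverse zlim0 zlim_opp zlim_add.
Proof.
move=> X; have [k [x ->]] := dl_inP X.
by rewrite (zlim0E k) zlim_oppE zlim_addE addNr.
Qed.

HB.instance Definition _ := GRing.isZmodule.Build zmod_dirlim
  zlim_addA zlim_addC zlim_add0 zlim_addN.

Fact zlim_in_is_zmod_morphism k : zmod_morphism (@zlim_in k).
Proof. by move=> x y; rewrite -zlim_addE -zlim_oppE. Qed.

HB.instance Definition _ k := GRing.isZmodMorphism.Build (A k) zmod_dirlim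
  (@zlim_in k) (@zlim_in_is_zmod_morphism k).

End ZmodDirectLimit.

Section RingDirectLimit.
Variables (A : nat -> pzRingType) (f : forall k, {rmorphism A k -> A k.+1}).

Definition ring_dirlim : Type :=
  @zmod_dirlim (fun k => A k) (fun k => f k).

HB.instance Definition _ := GRing.Zmodule.on ring_dirlim.

Definition rlim_in k (x : A k) : ring_dirlim :=
  @zlim_in (fun k => A k) (fun k => f k) k x.

HB.instance Definition _ k := GRing.isZmodMorphism.Build (A k) ring_dirlim
  (@rlim_in k) (@zlim_in_is_zmod_morphism (fun k => A k) (fun k => f k) k).

Let rlim1 : ring_dirlim := rlim_in (1 : A 0).
Let rlim_mul : ring_dirlim -> ring_dirlim -> ring_dirlim :=
  dl_op2 _ (fun k x y => x * y).

Let rlim1E k : rlim1 = rlim_in (1 : A k).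
Proof.
elim: k => // k ->; rewrite -[in RHS](rmorph1 (f k)).
exact/esym/(@dl_inS (fun k => A k) (fun k => f k)).
Qed.

Let rlim_mulE k (x y : A k) :
  rlim_mul (rlim_in x) (rlim_in y) = rlim_in (x * y).
Proof. by apply: dl_op2E => {}k {}x {}y; exact/esym/rmorphM. Qed.

Let rlim_inD k (x y : A k) : rlim_in (x + y) = rlim_in x + rlim_in y.
Proof. exact: raddfD. Qed.

Let rlim_mulA : associative rlim_mul.
Proof.
move=> X Y Z; have [k [x [y [z [-> -> ->]]]]] := dl_inP3 X Y Z.
by rewrite !rlim_mulE mulrA.
Qed.

Let rlim_mul1r : left_id rlim1 rlim_mul.
Proof.
by move=> X; have [k [x ->]] := dl_inP X; rewrite (rlim1E k) rlim_mulE mul1r.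
Qed.

Let rlim_mulr1 : right_id rlim1 rlim_mul.
Proof.
by move=> X; have [k [x ->]] := dl_inP X; rewrite (rlim1E k) rlim_mulE mulr1.
Qed.

Let rlim_mulDl : left_distributive rlim_mul +%R.
Proof.
move=> X Y Z; have [k [x [y [z [-> -> ->]]]]] := dl_inP3 X Y Z.
by rewrite -[dl_in _ x]/(rlim_in x) -rlim_inD !rlim_mulE mulrDl rlim_inD.
Qed.

Let rlim_mulDr : right_distributive rlim_mul +%R.
Proof.
move=> X Y Z; have [k [x [y [z [-> -> ->]]]]] := dl_inP3 X Y Z.
by rewrite -[dl_in _ y]/(rlim_in y) -rlim_inD !rlim_mulE mulrDr rlim_inD.
Qed.

HB.instance Definition _ := GRing.Zmodule_isPzRing.Build ring_dirlim
  rlim_mulA rlim_mul1r rlim_mulr1 rlim_mulDl rlim_mulDr.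

Fact rlim_in_is_monoid_morphism k : monoid_morphism (@rlim_in k).
Proof. by split=> [|x y]; [rewrite -rlim1E | rewrite -rlim_mulE]. Qed.

HB.instance Definition _ k := GRing.isMonoidMorphism.Build (A k) ring_dirlim
  (@rlim_in k) (@rlim_in_is_monoid_morphism k).

End RingDirectLimit.

Section LmodDirectLimit.
Variables (A : nat -> pzRingType) (f : forall k, {rmorphism A k -> A k.+1}).
Variables (M : forall k, lmodType (A k)).
Variables (g : forall k, {linear M k -> M k.+1 | (f k \; *:%R)}).

Definition lmod_dirlim : Type :=
  @zmod_dirlim (fun k => M k) (fun k => g k).

HB.instance Definition _ := GRing.Zmodule.on lmod_dirlim.

Definition mlim_in k (x : M k) : lmod_dirlim :=
  @zlim_in (fun k => M k) (fun k => g k) k x.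

HB.instance Definition _ k := GRing.isZmodMorphism.Build (M k) lmod_dirlim
  (@mlim_in k) (@zlim_in_is_zmod_morphism (fun k => M k) (fun k => g k) k).

Let mlim_scale : ring_dirlim f -> lmod_dirlim -> lmod_dirlim :=
  dl_op2 _ (fun k a x => a *: x).

Let mlim_scaleE k (a : A k) (x : M k) :
  mlim_scale (rlim_in f a) (mlim_in x) = mlim_in (a *: x).
Proof. by apply: dl_op2E => {}k {}a {}x; rewrite [RHS]linearZ_LR. Qed.

Let mlim_inD k (x y : M k) : mlim_in (x + y) = mlim_in x + mlim_in y.
Proof. exact: raddfD. Qed.

Let mlim_scaleA a b v : mlim_scale a (mlim_scale b v) = mlim_scale (a * b) v.
Proof.
have [k [{}a [{}b [{}v [-> -> ->]]]]] := dl_inP3 a b v.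
rewrite -[dl_in _ a]/(rlim_in f a) -[dl_in _ b]/(rlim_in f b).
by rewrite -rmorphM !mlim_scaleE scalerA.
Qed.

Let mlim_scale1 : left_id 1 mlim_scale.
Proof.
move=> X; have [k [x ->]] := dl_inP X.
by rewrite -(rmorph1 (@rlim_in A f k)) mlim_scaleE scale1r.
Qed.

Let mlim_scaleDr : right_distributive mlim_scale +%R.
Proof.
move=> a u v; have [k [{}a [{}u [{}v [-> -> ->]]]]] := dl_inP3 a u v.
by rewrite -[dl_in _ u]/(mlim_in u) -mlim_inD !mlim_scaleE scalerDr mlim_inD.
Qed.

Let mlim_scaleDl v : {morph mlim_scale^~ v : a b / a + b}.
Proof.
move=> a b; have [k [{}a [{}b [{}v [-> -> ->]]]]] := dl_inP3 a b v.
rewrite -[dl_in _ a]/(rlim_in f a) -[dl_in _ b]/(rlim_in f b).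
by rewrite -raddfD !mlim_scaleE scalerDl mlim_inD.
Qed.

HB.instance Definition _ := GRing.Zmodule_isLmodule.Build (ring_dirlim f)
  lmod_dirlim mlim_scaleA mlim_scale1 mlim_scaleDr mlim_scaleDl.

Lemma mlim_inZ k (a : A k) (x : M k) :
  mlim_in (a *: x) = rlim_in f a *: mlim_in x :> lmod_dirlim.
Proof. by rewrite -mlim_scaleE. Qed.

End LmodDirectLimit.

Section MatricialClosure.
Variable n : nat.

Fact block_size k : (\sum_(i < n) n ^ k = n ^ k.+1)%N.
Proof. by rewrite sum_nat_const card_ord expnS. Qed.

(* The r-th index of the i-th block. *)
Definition block_index k (i : 'I_n) (r : 'I_(n ^ k)) : 'I_(n ^ k.+1) :=
  cast_ord (block_size k) (tagnat.Rank i r).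

Lemma block_index_val k (i : 'I_n) (r : 'I_(n ^ k)) :
  block_index i r = (i * n ^ k + r)%N :> nat.
Proof.
rewrite [LHS]tagnat.RankEsum.
rewrite -(big_ord_widen n (fun=> (n ^ k)%N) (ltnW (ltn_ord i))).
by rewrite sum_nat_const card_ord.
Qed.

Lemma block_indexP k (s : 'I_(n ^ k.+1)) : exists i r, s = block_index i r.
Proof.
pose t := cast_ord (esym (block_size k)) s.
exists (tagnat.sig1 t), (tagnat.sig2 t).
by rewrite /block_index tagnat.sig2K cast_ordKV.
Qed.

Lemma big_block_index (V : nmodType) k (F : 'I_(n ^ k.+1) -> V) :
  \sum_s F s = \sum_(i < n) \sum_(r < n ^ k) F (block_index i r).
Proof.
rewrite sig_big_dep (reindex (fun p => cast_ord (block_size k) (tagnat.rank p))).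
  by apply: eq_bigr => -[].
apply: onW_bij; exists (tagnat.sig \o cast_ord (esym (block_size k))) => x /=.
  by rewrite cast_ordK tagnat.rankK.
by rewrite tagnat.sigK cast_ordKV.
Qed.

Section Ring.
Variable R : pzRingType.

Definition diag_embed k (A : 'M[R]_(n ^ k)) : 'M[R]_(n ^ k.+1) :=
  castmx (block_size k, block_size k) (\mxdiag_(i < n) A).

Lemma diag_embedE k (A : 'M[R]_(n ^ k)) i r j s :
  diag_embed A (block_index i r) (block_index j s) =
  if i == j then A r s else 0.
Proof.
rewrite castmxE !cast_ordK !mxE /tagnat.sig1 /tagnat.sig2 /tagnat.Rank.
by rewrite !tagnat.rankK /=; case: eqP; rewrite ?conform_mx_id ?mxE.
Qed.

Fact diag_embed_is_zmod_morphism k : zmod_morphism (@diag_embed k).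
Proof.
move=> A B; rewrite /diag_embed.
by case: _ / (block_size k); rewrite !castmx_id mxdiagB.
Qed.

Fact diag_embed_is_monoid_morphism k : monoid_morphism (@diag_embed k).
Proof.
rewrite /diag_embed; split=> [|A B]; case: _ / (block_size k); rewrite !castmx_id.
  exact: mxdiagZ.
rewrite -[RHS]/(_ *m _) {2}/mxdiag mul_mxdiag_mxblock; apply/eq_mxblock => i j.
  by case: eqVneq => _; rewrite ?conform_mx_id ?mulmx0.
Qed.

HB.instance Definition _ k := GRing.isZmodMorphism.Build _ _
  (@diag_embed k) (@diag_embed_is_zmod_morphism k).
HB.instance Definition _ k := GRing.isMonoidMorphism.Build _ _
  (@diag_embed k) (@diag_embed_is_monoid_morphism k).

Definition MC : Type :=
  @ring_dirlim (fun k => 'M[R]_(n ^ k)) (fun k => @diag_embed k).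

HB.instance Definition _ := GRing.PzRing.on MC.

Definition MC_in k (A : 'M[R]_(n ^ k)) : MC :=
  @rlim_in (fun k => 'M[R]_(n ^ k)) (fun k => @diag_embed k) k A.

End Ring.

Section Module.
Variables (R : pzRingType) (M : lmodType R).

(* The alias keeps the 'M[R]_(n ^ k)-action apart from the structures that
   'cV[M]_(n ^ k) may carry when M is itself a ring. *)
Definition delta k : Type := 'cV[M]_(n ^ k).

HB.instance Definition _ k := GRing.Zmodule.on (delta k).

Definition delta_scale k (A : 'M[R]_(n ^ k)) (v : delta k) : delta k :=
  \col_r \sum_s A r s *: v s 0.

Fact delta_scaleA k (A B : 'M[R]_(n ^ k)) v :
  delta_scale A (delta_scale B v) = delta_scale (A * B) v.
Proof.
apply/colP => r; rewrite !mxE.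
under eq_bigr do rewrite mxE scaler_sumr.
rewrite exchange_big; apply: eq_bigr => t _.
by rewrite mxE scaler_suml; apply: eq_bigr => s _; rewrite scalerA.
Qed.

Fact delta_scale1 k : left_id 1 (@delta_scale k).
Proof.
move=> v; apply/colP => r; rewrite mxE (bigD1 r) //= mxE eqxx scale1r.
by rewrite big1 ?addr0 // => s /negPf sr; rewrite mxE eq_sym sr scale0r.
Qed.

Fact delta_scaleDr k : right_distributive (@delta_scale k) +%R.
Proof.
move=> A u v; apply/colP => r; rewrite !mxE -big_split.
by apply: eq_bigr => s _; rewrite mxE scalerDr.
Qed.

Fact delta_scaleDl k v : {morph (@delta_scale k)^~ v : A B / A + B}.
Proof.
move=> A B; apply/colP => r; rewrite !mxE -big_split.
by apply: eq_bigr => s _; rewrite mxE scalerDl.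
Qed.

HB.instance Definition _ k := GRing.Zmodule_isLmodule.Build 'M[R]_(n ^ k)
  (delta k) (@delta_scaleA k) (@delta_scale1 k) (@delta_scaleDr k)
  (@delta_scaleDl k).

Lemma delta_scaleE k (A : 'M[R]_(n ^ k)) (v : delta k) r :
  (A *: v) r 0 = \sum_s A r s *: v s 0.
Proof. exact: mxE. Qed.

(* v |-> (v, ..., v), with n blocks. *)
Definition diag_map k (v : delta k) : delta k.+1 :=
  castmx (block_size k, erefl) (\mxcol_(i < n) v).

Lemma diag_mapE k (v : delta k) i r :
  diag_map v (block_index i r) 0 = v r 0.
Proof.
rewrite castmxE cast_ordK cast_ord_id mxE /tagnat.sig2 /tagnat.Rank.
by rewrite tagnat.rankK.
Qed.

Fact diag_map_is_zmod_morphism k : zmod_morphism (@diag_map k).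
Proof.
by move=> u v; apply/colP => r; rewrite !mxE !castmxE !mxE.
Qed.

Fact diag_map_scalable k :
  scalable_for (diag_embed (k := k) \; *:%R) (@diag_map k).
Proof.
move=> A v; apply/colP => r; have [i [r' ->]] := block_indexP r.
rewrite diag_mapE !delta_scaleE big_block_index (bigD1 i) //= [X in _ + X]big1.
  by rewrite addr0; apply: eq_bigr => s _; rewrite diag_embedE eqxx diag_mapE.
move=> j ji; rewrite big1 // => s _.
by rewrite diag_embedE eq_sym (negPf ji) scale0r.
Qed.

HB.instance Definition _ k := GRing.isZmodMorphism.Build _ _
  (@diag_map k) (@diag_map_is_zmod_morphism k).
HB.instance Definition _ k := GRing.isScalable.Build _ _ _ _
  (@diag_map k) (@diag_map_scalable k).

Definition Delta : Type :=
  @lmod_dirlim (fun k => 'M[R]_(n ^ k)) (fun k => @diag_embed R k)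
    (fun k => delta k) (fun k => @diag_map k).

HB.instance Definition _ := GRing.Zmodule.on Delta.
HB.instance Definition _ := GRing.Lmodule.on Delta.

Definition Delta_in k (v : delta k) : Delta :=
  @mlim_in (fun k => 'M[R]_(n ^ k)) (fun k => @diag_embed R k)
    (fun k => delta k) (fun k => @diag_map k) k v.

Lemma Delta_in0 k : Delta_in (0 : delta k) = 0.
Proof. exact: raddf0. Qed.

Lemma Delta_inD k (u v : delta k) : Delta_in (u + v) = Delta_in u + Delta_in v.
Proof. exact: raddfD. Qed.

Lemma Delta_inZ k (A : 'M[R]_(n ^ k)) (v : delta k) :
  Delta_in (A *: v) = (MC_in A : MC R) *: Delta_in v.
Proof. exact: (@mlim_inZ (fun k => 'M[R]_(n ^ k)) (fun k => @diag_embed R k)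
  (fun k => delta k) (fun k => @diag_map k)). Qed.

Lemma Delta_inS k (v : delta k) : Delta_in (diag_map v) = Delta_in v.
Proof. exact: (@dl_inS (fun k => delta k) (fun k => @diag_map k)). Qed.

End Module.

End MatricialClosure.

(* Classically every submodule is given by a boolean predicate. *)
Definition simple_lmod (R : pzRingType) (V : lmodType R) : Prop :=
  (exists v : V, v != 0) /\
  forall U : {pred V}, submod_closed U -> U =i pred1 0 \/ U =i predT.

(* Main.v *)
(** Simplicity of a module V means that V is nonzero and every nonzero vector
    generates it.  In the column module S^(n^k), a vector v with an entry
    v_r <> 0 generates everything: pick a_s with w_s = a_s v_r and let A have
    the a_s as its r-th column and zeros elsewhere, so that A v = w.  Two
    elements of Delta(S) live at a common stage k, so the property passes to the
    limit.  The limit is nonzero since the diagonal maps are injective, which is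
    where n > 0 is needed. *)
Require Import Defs.
From mathcomp Require Import all_boot all_order all_algebra.
From mathcomp Require Import boolp.

Set Implicit Arguments.
Unset Strict Implicit.
Unset Printing Implicit Defensive.

Import GRing.Theory.
Local Open Scope ring_scope.

Lemma simple_lmodP (R : pzRingType) (V : lmodType R) :
  simple_lmod V <->
  (exists v : V, v != 0) /\
  (forall x y : V, x != 0 -> exists a : R, y = a *: x).
Proof.
split=> -[V_neq0 V_simple]; split=> //.
  move=> x y x_neq0.
  (* The cyclic submodule generated by [x], made boolean classically. It contains [1 *: x], hence is
     nonzero, so simplicity makes it all of [V]. *)
  have cyclic_closed : submod_closed [pred z | `[< exists a : R, z = a *: x >]].
    split; first by apply/asboolP; exists 0; rewrite scale0r.
    move=> a u v /asboolP[b ->] /asboolP[c ->]; apply/asboolP.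
    by exists (a * b + c); rewrite scalerA scalerDl.
  case: (V_simple _ cyclic_closed) => [/(_ x) | /(_ y)].
    rewrite !inE (negPf x_neq0) => /asboolP[].
    by exists 1; rewrite scale1r.
  by rewrite !inE => /asboolP.
move=> U [U0 UZD].
have [U_nonzero | /forallNP U_zero] := pselect (exists x, x \in U /\ x != 0).
  have [x [Ux x_neq0]] := U_nonzero; right=> y.
  have [a ->] := V_simple x y x_neq0.
  by rewrite inE -[a *: x]addr0 UZD.
left=> x; rewrite inE; apply/idP/eqP => [Ux | -> //].
by have /not_andP[/(_ Ux) | /negP/negPn/eqP] := U_zero x.
Qed.

(** Equality in the limit is equality at some later stage [m], and composites of injective
    connecting maps are injective. *)
Lemma dl_in_inj (T : nat -> choiceType) (f : forall k, T k -> T k.+1) :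
  (forall k, injective (f k)) -> forall k, injective (@dl_in T f k).
Proof.
move=> f_inj k x y /dl_in_eqP[m [km [km' +]]].
rewrite (dl_map_irr f km' km) => {km'}.
elim: m km => [|m IHm] km.
  have k0 : k = 0%N by apply/eqP; rewrite -leqn0.
  by subst k; rewrite !dl_map_id.
have [km' | mk] := leqP k m.
  by rewrite !(dl_mapS f km') => /f_inj; apply: IHm.
have kE : k = m.+1 by apply/eqP; rewrite eqn_leq km.
by subst k; rewrite !dl_map_id.
Qed.

Section MatricialClosure.
Variables (n : nat) (R : pzRingType) (M : lmodType R).

Lemma diag_map_inj k : (0 < n)%N -> injective (@diag_map n R M k).
Proof.
move=> n_gt0 u v uv; apply/colP => r.
(* Since [0 < n], there is a block 0, from which the entries of [u] and [v] are read off. *)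
by rewrite -(diag_mapE u (Ordinal n_gt0)) uv diag_mapE.
Qed.

Lemma Delta_in_inj k : (0 < n)%N -> injective (@Delta_in n R M k).
Proof.
by move=> n_gt0; apply: dl_in_inj => {}k; apply: diag_map_inj.
Qed.

Lemma delta_transitive k (v w : delta n M k) :
  simple_lmod M -> v != 0 -> exists A : 'M[R]_(n ^ k), w = A *: v.
Proof.
move=> /simple_lmodP[_ M_trans] v_neq0.
have [r vr_neq0] : exists r, v r 0 != 0.
  apply/existsP; apply: contraNT v_neq0 => /existsPn v0.
  by apply/eqP/colP => r; rewrite mxE; apply/eqP/negPn/v0.
have [a wE] := choice (fun s => M_trans (v r 0) (w s 0) vr_neq0).
exists (\matrix_(s, t) if t == r then a s else 0).
apply/colP => s; rewrite delta_scaleE (bigD1 r) //= mxE eqxx -wE.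
by rewrite big1 ?addr0 // => t /negPf tr; rewrite mxE tr scale0r.
Qed.

End MatricialClosure.

Theorem proposition15 (n : nat) (n_gt0 : (0 < n)%N) (R : pzRingType)
    (S : lmodType R) :
  simple_lmod S -> @simple_lmod (MC n R) (Delta n S).
Proof.
move=> S_simple; apply/simple_lmodP; split.
  have [[x x_neq0] _] := S_simple.
  exists (Delta_in (const_mx x : delta n S 0)).
  rewrite -(Delta_in0 n S 0) (inj_eq (Delta_in_inj n_gt0)).
  (* [n ^ 0] computes to 1, so [isT] yields the only index of a column at stage 0. *)
  apply: contraNneq x_neq0 => /colP/(_ (Ordinal (isT : (0 < n ^ 0)%N))).
  by rewrite !mxE => ->.
move=> X Y; have [k [v [w [-> ->]]]] := dl_inP2 X Y.
rewrite -[dl_in _ v]/(Delta_in v) -[dl_in _ w]/(Delta_in w) => X_neq0.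
have v_neq0 : v != 0 by apply: contraNneq X_neq0 => ->; rewrite Delta_in0.
have [A ->] := delta_transitive w S_simple v_neq0.
by exists (MC_in A); rewrite Delta_inZ.
Qed.
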